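(* For every graph $G$ with $\chi(G)\le 4$ and every integer $d\ge 0$, $$\chi(G)=\chi^d(G\boxtimes K_{d+1}).$$
   Context: Graphs are finite and simple. $\chi$ is the usual chromatic number. A colouring of a graph is $d$-improper if each vertex $v$ has at most $d$ neighbours of the same colour as $v$; $\chi^d$ denotes the least number of colours in a $d$-improper colouring. The strong product $G\boxtimes H$ has vertex set $V(G)\times V(H)$, where $(u,u')$ and $(v,v')$ are adjacent if (i) $u=v$ and $u'\sim v'$ in $H$, or (ii) $u'=v'$ and $u\sim v$ in $G$, or (iii) $u\sim v$ in $G$ and $u'\sim v'$ in $H$. $K_{d+1}$ is the complete graph on $d+1$ vertices. *)

(* Defs.v *)
From mathcomp Require Import all_boot.

Set Implicit Arguments.
Unset Strict Implicit.
Unset Printing Implicit Defensive.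

Record sgraph := SGraph {
  vertex :> finType;
  adj : rel vertex;
  adj_sym : symmetric adj;
  adj_irrefl : irreflexive adj
}.

Section Colourings.
Variable G : sgraph.

Definition proper_colouring (k : nat) (c : {ffun G -> 'I_k}) : bool :=
  [forall u : G, forall v : G, adj u v ==> (c u != c v)].

Definition improper_colouring (d k : nat) (c : {ffun G -> 'I_k}) : bool :=
  [forall v : G, #|[set w : G | adj v w && (c w == c v)]| <= d].

Definition colourable (k : nat) : bool :=
  [exists c : {ffun G -> 'I_k}, proper_colouring c].

Definition improper_colourable (d k : nat) : bool :=
  [exists c : {ffun G -> 'I_k}, improper_colouring d c].

Lemma colourable_ex : exists k, colourable k.
Proof.
exists #|G|; apply/existsP; exists [ffun v => enum_rank v].
apply/forallP => u; apply/forallP => v; apply/implyP => uv.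
rewrite !ffunE; apply/eqP => /enum_rank_inj euv.
by rewrite euv adj_irrefl in uv.
Qed.

Lemma improper_colourable_ex (d : nat) : exists k, improper_colourable d k.
Proof.
exists #|G|; apply/existsP; exists [ffun v => enum_rank v].
apply/forallP => v; rewrite (_ : [set _ | _] = set0) ?cards0 //.
apply/setP => w; rewrite !inE !ffunE (inj_eq enum_rank_inj).
by apply/andP => -[vw /eqP ewv]; rewrite ewv adj_irrefl in vw.
Qed.

Definition chi : nat := ex_minn colourable_ex.

Definition chi_improper (d : nat) : nat := ex_minn (improper_colourable_ex d).

End Colourings.

Section StrongProduct.
Variables G H : sgraph.

Definition strong_adj : rel (G * H)%type := fun x y =>
  [|| (x.1 == y.1) && adj x.2 y.2,
      (x.2 == y.2) && adj x.1 y.1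
    | adj x.1 y.1 && adj x.2 y.2].

Lemma strong_adj_sym : symmetric strong_adj.
Proof.
move=> x y; rewrite /strong_adj (eq_sym x.1) (eq_sym x.2).
by rewrite (adj_sym x.1) (adj_sym x.2).
Qed.

Lemma strong_adj_irrefl : irreflexive strong_adj.
Proof. by move=> x; rewrite /strong_adj !adj_irrefl !andbF. Qed.

Definition strong_product : sgraph := SGraph strong_adj_sym strong_adj_irrefl.

End StrongProduct.

Section CompleteGraph.
Variable n : nat.

Definition complete_adj : rel 'I_n := fun i j => i != j.

Lemma complete_adj_sym : symmetric complete_adj.
Proof. by move=> i j; rewrite /complete_adj eq_sym. Qed.

Lemma complete_adj_irrefl : irreflexive complete_adj.
Proof. by move=> i; rewrite /complete_adj eqxx. Qed.

Definition complete_graph : sgraph :=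
  SGraph complete_adj_sym complete_adj_irrefl.

End CompleteGraph.

(* Main.v *)
Require Import Defs.
From mathcomp Require Import all_boot.
From mathcomp Require Import zify.

(** Colouring all copies of a vertex alike turns a proper colouring of G into
    a d-improper colouring of the product, each vertex having only its d twins
    as neighbours of the same colour ([chi_improper_le]).

    For the converse it is enough to show that when the product has a
    d-improper colouring with at most 3 colours, G has a proper colouring with
    the same colours: if the product needs 4 colours, the bound chi G <= 4
    finishes the proof.  Put n = d + 1 and let a v i be the number of copies
    of v coloured i.  The numbers a v i sum to n over i, and improperness says
    that a colour used at v has total weight at most n over the closed
    neighbourhood of v.  With at most 3 colours each vertex is of one of three
    kinds ([weight_trichotomy]).

    - All colours are used at v.  Summing over the colours, the closed
      neighbourhood has no more vertices than there are colours, so v can be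
      coloured greedily after everything else ([full_support_degree],
      [greedy_extension]).
    - Some colour has weight more than n/2 at v.  Give v this colour; a
      neighbour has weight less than n/2 on it and never takes it.
    - The weight is split equally, n/2 each, between two colours.  One of
      these two must be chosen.  Among such tied vertices, at most one
      neighbour of v shares a given colour of v, so the conflicts on one
      colour form a matching.  Call slot of v for the colour i the pair of i
      and the set of v and its rival for i, if any.  Each tied vertex joins its
      two slots, each slot is an end of at most two vertices, and a choice of
      colours without conflict is an injective choice of ends.  It exists
      because a multigraph of maximum degree 2 is made of paths and cycles,
      whose edges can be oriented consistently ([choose_ends]). *)

(** * Orienting multigraphs of maximum degree 2 *)

(** Here [V] is the type of edges of a multigraph on [S], the edge [v] has
    ends [p v] and [q v], and [s] picks the head of each edge.  If no other
    edge meets [v] at [q v], let [v] point there.  Otherwise the unique edge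
    [u] meeting [v] there is merged with [v] into one edge that avoids [q v],
    and an orientation of the merged edge is passed on to both halves, exactly
    one of which then points to [q v].  Merging may create loops and parallel
    edges, hence multiplicities in the degree condition. *)
Lemma choose_ends (V : finType) (S : eqType) (D : {set V}) (p q : V -> S) :
    (forall z, \sum_(v in D) ((p v == z) + (q v == z)) <= 2) ->
  exists2 s : V -> S, {in D, forall v, s v = p v \/ s v = q v}
                    & {in D &, injective s}.
Proof.
have [m] := ubnP #|D|; elim: m => // m IHm in D p q *.
rewrite ltnS => leDm deg2.
have [->|[v vD]] := set_0Vmem D.
  by exists p => [v|v u]; rewrite inE.
have ltD : #|D :\ v| < m by rewrite (cardsD1 v D) vD in leDm.
have degD z : \sum_(x in D) ((p x == z) + (q x == z)) =
    ((p v == z) + (q v == z)) + \sum_(x in D :\ v) ((p x == z) + (q x == z)).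
  by rewrite (big_setD1 v).
have extend (s : V -> S) w : w = p v \/ w = q v ->
    {in D :\ v, forall x, s x = p x \/ s x = q x} ->
    {in D :\ v &, injective s} -> {in D :\ v, forall x, s x != w} ->
  exists2 s : V -> S, {in D, forall v, s v = p v \/ s v = q v}
                    & {in D &, injective s}.
  move=> wE sE s_inj s_w.
  have D'P x : x \in D -> x != v -> x \in D :\ v.
    by move=> xD xv; rewrite !inE xv.
  exists (fun x => if x == v then w else s x) => [x xD|x y xD yD].
    by case: eqVneq => [->|xv] //; apply/sE/D'P.
  case: (eqVneq x v) => [->|xv]; case: (eqVneq y v) => [->|yv] // exy.
  - by have := s_w y (D'P y yD yv); rewrite -exy eqxx.
  - by have := s_w x (D'P x xD xv); rewrite exy eqxx.
  - by apply: s_inj; rewrite ?D'P.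
pose free := [forall u in D :\ v, (p u != q v) && (q u != q v)].
have [/forall_inP freev|/forall_inPn[u uD']] := boolP free.
  have [|s sE s_inj] := IHm (D :\ v) p q ltD.
    by move=> z; apply: leq_trans (deg2 z); rewrite degD leq_addl.
  apply: (extend s (q v)) => // [|x xD']; first by right.
  by have /andP[] := freev x xD'; case: (sE x xD') => ->.
move=> u_end.
(* b is the far end of u; v and u are merged into an edge from p v to b. *)
pose b := if p u == q v then q u else p u.
have endsu z : (p u == z) + (q u == z) = (q v == z) + (b == z).
  move: u_end; rewrite /b; case: (eqVneq (p u) (q v)) => [->|_] //=.
  by rewrite negbK => /eqP->; rewrite addnC.
pose p' x := if x == u then p v else p x.
pose q' x := if x == u then b else q x.
have degD' z : \sum_(x in D :\ v) ((p x == z) + (q x == z)) =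
   (q v == z) + (b == z)
     + \sum_(x in D :\ v :\ u) ((p x == z) + (q x == z)).
  by rewrite (big_setD1 u) //= endsu.
have [|s sE s_inj] := IHm (D :\ v) p' q' ltD.
  move=> z; rewrite (big_setD1 u) //= /p' /q' eqxx.
  rewrite (eq_bigr (fun x => (p x == z) + (q x == z))) => [|x]; last first.
    by rewrite !inE => /andP[/negPf->].
  by have := deg2 z; rewrite degD degD'; clear; lia.
(* The edges v and u exhaust the degree of q v. *)
have rest x : x \in D :\ v -> x != u ->
    [/\ s x = p x \/ s x = q x, s x != q v & s x != s u].
  move=> xD' xu; have sx : s x = p x \/ s x = q x.
    by have := sE x xD'; rewrite /p' /q' (negPf xu).
  split=> //; last by apply: contra xu => /eqP/s_inj->.
  have := deg2 (q v).
  rewrite degD degD' (big_setD1 x) 1?in_setD1 ?xu ?xD' //= eqxx.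
  by case: sx => ->; apply: contraTneq => ->; rewrite eqxx -ltnNge; clear; lia.
have [pvqv bqv] : p v != q v /\ b != q v.
  have := deg2 (q v); rewrite degD degD' eqxx => deg2v; split.
    by apply: contraTneq deg2v => ->; rewrite eqxx -ltnNge; clear; lia.
  by apply: contraTneq deg2v => ->; rewrite eqxx -ltnNge; clear; lia.
have [su|su] : s u = p v \/ s u = b.
- by have := sE u uD'; rewrite /p' /q' eqxx.
- apply: (extend (fun x => if x == u then q v else s x) (p v)).
  + by left.
  + move=> x xD'; case: eqVneq => [->|xu]; last by case: (rest x xD' xu).
    by move: u_end; rewrite negb_and !negbK => /orP[]/eqP<-; [left | right].
  + move=> x y xD' yD'.
    case: (eqVneq x u) => [->|xu]; case: (eqVneq y u) => [->|yu] //.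
    * by move=> e; case: (rest y yD' yu) => _; rewrite -e eqxx.
    * by move=> e; case: (rest x xD' xu) => _; rewrite e eqxx.
    * exact: s_inj.
  + move=> x xD'; case: (eqVneq x u) => [_|xu]; first by rewrite eq_sym.
    by rewrite -su; case: (rest x xD' xu).
apply: (extend s (q v)) => // [|x xD'|x xD']; first by right.
  case: (eqVneq x u) => [->|xu]; last by case: (rest x xD' xu).
  by rewrite su /b; case: ifP => _; [right | left].
by case: (eqVneq x u) => [->|xu]; [rewrite su | case: (rest x xD' xu)].
Qed.

(** * Colouring vertices of small degree last *)

(** The values of [c] on [R] are provisional.  They are corrected one vertex at
    a time, with a colour absent from the whole neighbourhood: the degree bound
    leaves one even when provisional colours are avoided too. *)
Lemma greedy_extension (G : sgraph) (C : finType) (R : {set G}) (c : G -> C) :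
    {in R, forall v, #|[set w | adj v w]| < #|C|} ->
    (forall u v, u \notin R -> v \notin R -> adj u v -> c u != c v) ->
  exists c' : G -> C, forall u v, adj u v -> c' u != c' v.
Proof.
have [m] := ubnP #|R|; elim: m => // m IHm in R c *.
rewrite ltnS => leRm degR propc.
have [R0|[v vR]] := set_0Vmem R.
  by exists c => u v; apply: propc; rewrite R0 inE.
have /subsetPn[i _ iN] : ~~ ([set: C] \subset c @: [set w | adj v w]).
  apply/negP => /subset_leq_card; rewrite cardsT leqNgt.
  by rewrite (leq_ltn_trans (leq_imset_card _ _)) ?degR.
have ci w : adj v w -> c w != i.
  by move=> vw; apply: contra iN => /eqP<-; rewrite imset_f ?inE.
apply: (IHm (R :\ v) (fun x => if x == v then i else c x)).
- by rewrite (cardsD1 v R) vR in leRm.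
- by move=> x /setD1P[_ /degR].
move=> x y; rewrite !inE !negb_and !negbK.
case: eqVneq => [->|xv] /= xR; case: eqVneq => [->|yv] /= yR.
- by rewrite adj_irrefl.
- by rewrite eq_sym; apply: ci.
- by rewrite adj_sym; apply: ci.
- by apply: propc.
Qed.

(** * Proper colourings from weights *)

(** The weights [a v i] abstract the numbers of copies of [v] with colour [i];
    [a_local] is what improperness of the colouring says about them. *)
Section Weights.
Variables (G : sgraph) (C : finType) (n : nat) (a : G -> C -> nat).
Hypothesis n_gt0 : 0 < n.
Hypothesis a_total : forall v, \sum_i a v i = n.
Hypothesis a_local : forall v i, 0 < a v i ->
  a v i + \sum_(w | adj v w) a w i <= n.

(** Summed over all colours, the left-hand side of [a_local] is [n] times the
    size of the closed neighbourhood of [v], the right-hand side [n] times the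
    number of colours. *)
Lemma full_support_degree v :
  (forall i, 0 < a v i) -> #|[set w | adj v w]| < #|C|.
Proof.
move=> av; rewrite -(ltn_pmul2r n_gt0).
have: \sum_i (a v i + \sum_(w | adj v w) a w i) <= \sum_(i : C) n.
  by apply: leq_sum => i _; apply: a_local.
rewrite big_split /= a_total exchange_big /=.
rewrite (eq_bigr (fun=> n)) ?sum_nat_const => [|w _]; last exact: a_total.
by rewrite cardsE; apply: leq_trans; rewrite -add1n leq_add2r.
Qed.

Lemma colour_used v : exists i, 0 < a v i.
Proof.
apply/existsP; apply: contraTT n_gt0 => /existsPn a0.
by rewrite -(a_total v) big1 // => i _; apply/eqP; rewrite -leqn0 leqNgt a0.
Qed.

(** If a colour is unused at [v], the weight [n] is shared by at most two
    colours: unless one of them has more than half, both have exactly half. *)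
Lemma weight_trichotomy v : #|C| <= 3 ->
  [\/ forall i, 0 < a v i, exists i, n < 2 * a v i
    | exists ij : C * C,
        [/\ ij.1 != ij.2, 2 * a v ij.1 = n & 2 * a v ij.2 = n]].
Proof.
move=> C3.
have [/forallP|/forallPn[z]] := boolP [forall i, 0 < a v i]; first exact: Or31.
rewrite -eqn0Ngt => /eqP az.
have [/existsP|/existsPn small] := boolP [exists i, n < 2 * a v i].
  exact: Or32.
have {}small i : 2 * a v i <= n by rewrite leqNgt small.
apply: Or33.
have split_at i : a v i + \sum_(k | k != i) a v k = n.
  by rewrite -(a_total v) [RHS](bigD1 i).
have [i ai] := colour_used v.
have [j ji aj] : exists2 j, j != i & 0 < a v j.
  apply/exists_inP; apply: contraTT isT => /exists_inPn a0.
  have := split_at i; rewrite big1 => [|k ki]; last first.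
    by apply/eqP; rewrite -leqn0 leqNgt a0.
  by have := small i; lia.
have zi : z != i by apply: contraTneq ai => <-; rewrite az.
have zj : z != j by apply: contraTneq aj => <-; rewrite az.
have : a v i + a v j = n.
  rewrite -[RHS](split_at i) (bigD1 j) //= big1 ?addn0 // => k /andP[ki kj].
  (* A third used colour k would make i, j, k and z four colours. *)
  apply: contraTeq C3; rewrite -ltnNge => ak.
  have kz : k != z by apply: contraNneq ak => ->; rewrite az.
  apply: leq_trans (max_card (mem [:: i; j; z; k])).
  rewrite (card_uniqP _) //= !inE !negb_or.
  rewrite (eq_sym i j) (eq_sym i z) (eq_sym i k).
  rewrite (eq_sym j z) (eq_sym j k) (eq_sym z k).
  by rewrite ji zi ki zj kj kz.
move=> aij; exists (i, j) => /=; split; first by rewrite eq_sym.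
  by have := small i; have := small j; lia.
by have := small i; have := small j; lia.
Qed.

Lemma shared_weight u v i : adj u v -> 0 < a u i -> a u i + a v i <= n.
Proof.
move=> uv /a_local; apply: leq_trans.
by rewrite leq_add2l (bigD1 v) //= leq_addr.
Qed.

(** The lists [p v], [q v] carry half of [n] each, so by [a_local] at most one
    tied neighbour of [v] can compete with [v] for a given colour.  Two rivals
    for a colour [i] have the same slot, namely [i] with the pair that they
    form, and an injective choice of slots separates them. *)
Lemma tied_colouring (T : {set G}) (p q : G -> C) :
    {in T, forall v, [/\ p v != q v, 2 * a v (p v) = n & 2 * a v (q v) = n]} ->
  exists2 c : G -> C, {in T, forall v, 2 * a v (c v) = n}
    & {in T &, forall u v, adj u v -> c u != c v}.
Proof.
move=> tie.
pose on i := [pred v | (p v == i) || (q v == i)].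
have a_on v i : v \in T -> on i v -> 2 * a v i = n.
  by move=> /tie[_ pE qE] /orP[]/eqP<-.
pose block v i := [set w in T | ((w == v) || adj v w) && on i w].
have block2 v i : v \in T -> on i v -> #|block v i| <= 2.
  move=> vT iv; have av := a_on v i vT iv.
  have vB : v \in block v i by rewrite !inE vT eqxx.
  (* The other members are neighbours of v of weight n/2 on i, and v leaves
     them a total weight of n/2. *)
  rewrite (cardsD1 v) vB ltnS -(leq_pmul2r n_gt0) mul1n -sum_nat_const.
  have nbrs : 2 * \sum_(w | adj v w) a w i <= n.
    have /a_local : 0 < a v i by lia.
    by rewrite -(leq_pmul2l (isT : 0 < 2)) mulnDr av; lia.
  apply: leq_trans nbrs; rewrite big_distrr /=.
  rewrite [leqRHS](bigID [in block v i :\ v]) /=.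
  apply: leq_trans (leq_addr _ _).
  rewrite [leqRHS](eq_bigl [in block v i :\ v]) => [|w]; last first.
    by rewrite /= !inE; case: (eqVneq w v) => [->|_] /=;
      rewrite ?andbF //; case: (adj v w); rewrite ?andbF.
  apply: leq_sum => w; rewrite !in_set => /and4P[_ wT _ iw].
  by rewrite (a_on w).
have on_p v : on (p v) v by rewrite /= eqxx.
have on_q v : on (q v) v by rewrite /= eqxx orbT.
pose slot v i := (i, block v i).
have [|s sE s_inj] := @choose_ends G _ T (fun v => slot v (p v))
  (fun v => slot v (q v)).
- case=> i A.
  (* A vertex with slot (i, A) belongs to A, and has this slot only once
     because its two colours differ. *)
  have le1 v : v \in T ->
      (slot v (p v) == (i, A)) + (slot v (q v) == (i, A)) <=
      (v \in A) * (#|A| <= 2).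
    move=> vT; rewrite !xpair_eqE.
    have [pq _ _] := tie v vT.
    have vB j : on j v -> (v \in block v j) && (#|block v j| <= 2).
      by move=> jv; rewrite block2 // andbT inE vT eqxx; apply: jv.
    case: (eqVneq (p v) i) => [pi|_] /=; case: (eqVneq (q v) i) => [qi|_] //=.
    + by rewrite pi qi eqxx in pq.
    + case: eqP => // <-; by have /andP[-> ->] := vB _ (on_p v).
    + case: eqP => // <-; by have /andP[-> ->] := vB _ (on_q v).
  apply: (@leq_trans (\sum_(v in T) (v \in A) * (#|A| <= 2))).
    exact: leq_sum.
  rewrite -big_distrl /=.
  case: (leqP #|A| 2) => A2; rewrite ?muln0 ?muln1 //.
  apply: leq_trans A2; rewrite -sum1_card big_mkcond [leqRHS]big_mkcond /=.
  by apply: leq_sum => v _; case: (v \in T); case: (v \in A).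
have s_slot v : v \in T -> on (s v).1 v /\ s v = slot v (s v).1.
  by move=> vT; case: (sE v vT) => ->; split; 
    first [exact: on_p | exact: on_q | by []].
exists (fun v => (s v).1) => [v vT|u v uT vT uv].
  by apply: a_on => //; case: (s_slot v vT).
apply/eqP => euv.
have [iu su] := s_slot u uT; have [iv sv] := s_slot v vT.
rewrite -euv in iv sv; set i := (s u).1 in iu su iv sv.
have neq_uv : u != v by apply: contraTneq uv => ->; rewrite adj_irrefl.
have blockE x y : x \in T -> y \in T -> x != y -> adj x y ->
    on i x -> on i y -> block x i = [set x; y].
  move=> xT yT xy xAy ix iy; apply/esym/eqP.
  rewrite eqEcard cards2 xy block2 // andbT.
  apply/subsetP => w; rewrite in_set2 => /orP[]/eqP->; rewrite in_set.
    by rewrite xT eqxx; apply: ix.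
  by rewrite yT xAy orbT; apply: iy.
case/eqP: (neq_uv); apply: s_inj => //; rewrite su sv /slot.
by rewrite (blockE u v) // (blockE v u) // 1?setUC // 1?eq_sym // adj_sym.
Qed.

Lemma colouring_of_weights : #|C| <= 3 ->
  exists c : G -> C, forall u v, adj u v -> c u != c v.
Proof.
move=> C3.
pose M := [set v | [exists i, n < 2 * a v i]].
have /fin_all_exists[m mM] v : exists i, v \in M -> n < 2 * a v i.
  have [|_] := boolP (v \in M); last by have [i _] := colour_used v; exists i.
  by rewrite inE => /existsP[i]; exists i.
pose T := [set v | [exists ij : C * C,
  [&& ij.1 != ij.2, 2 * a v ij.1 == n & 2 * a v ij.2 == n]]].
have /fin_all_exists[pq pqT] v : exists ij : C * C, v \in T ->
    [/\ ij.1 != ij.2, 2 * a v ij.1 = n & 2 * a v ij.2 = n].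
  have [|_] := boolP (v \in T).
    rewrite inE => /existsP[ij /and3P[neq /eqP e1 /eqP e2]].
    by exists ij.
  by have [i _] := colour_used v; exists (i, i).
have [t tT t_proper] := @tied_colouring T (fst \o pq) (snd \o pq) pqT.
pose c v := if v \in M then m v else t v.
(* Each v in M or T has at least half of its weight on c v, and more than half
   when v is in M; two adjacent such vertices sharing a colour, not both tied,
   would exceed n. *)
have half v : v \in M :|: T -> n + (v \in M) <= 2 * a v (c v).
  rewrite inE /c; have [vM _|_ vT] := boolP (v \in M).
    by rewrite addn1 mM.
  by rewrite addn0 tT.
apply: (@greedy_extension G C (~: (M :|: T)) c) => [v|u v].
  rewrite !inE negb_or => /andP[vM vT]; apply: full_support_degree.
  have [//|[i iM]|[ij [neq e1 e2]]] := weight_trichotomy v C3.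
    by case/existsP: vM; exists i.
  by case/existsP: vT; exists ij; rewrite neq e1 e2 eqxx.
rewrite !in_setC !negbK => uD vD uv.
have hu := half u uD; have hv := half v vD.
have [uvT|uvM] := boolP ((u \notin M) && (v \notin M)).
  case/andP: uvT => uM vM; rewrite /c (negPf uM) (negPf vM).
  by move: uD vD; rewrite !in_setU (negPf uM) (negPf vM) => uT vT; apply: t_proper.
apply: contraNneq uvM => euv; rewrite -negb_or.
have le_n : a u (c u) + a v (c v) <= n.
  rewrite -euv; apply: shared_weight => //.
  by move: hu n_gt0; clear; lia.
by move: hu hv le_n; clear; case: (u \in M); case: (v \in M); lia.
Qed.

End Weights.

(** * Colourings of the strong product with a complete graph *)

Lemma chi_improper_le (G : sgraph) (d : nat) :
  chi_improper (strong_product G (complete_graph d.+1)) d <= chi G.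
Proof.
rewrite /chi; case: ex_minnP => k /existsP[c /forallP c_proper] _.
rewrite /chi_improper; case: ex_minnP => m _; apply.
apply/existsP; exists [ffun x => c x.1]; apply/forallP => -[v i].
have pair_inj : injective (fun j : 'I_d.+1 => (v, j)) by move=> j l [].
have card_copies : #|[set (v, j) | j in [set~ i]]| = d.
  by rewrite card_imset // cardsC1 card_ord.
rewrite -[leqRHS]card_copies; apply/subset_leq_card/subsetP.
case=> w j; rewrite !inE !ffunE /= => /andP[+ /eqP cwv].
have nadj : adj v w = false.
  by apply/negP => /(implyP (forallP (c_proper v) w)); rewrite cwv eqxx.
rewrite /strong_adj /= nadj !andbF !orbF => /andP[/eqP<- ij].
by apply: imset_f; rewrite !inE eq_sym.
Qed.

(** The closed neighbourhood of a copy of [v] in the product consists of all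
    copies of the closed neighbourhood of [v] in [G], so counting its vertices
    of a given colour gives the local condition on the weights. *)
Lemma colourable_of_improper (G : sgraph) (d k : nat) : k <= 3 ->
  improper_colourable (strong_product G (complete_graph d.+1)) d k ->
  colourable G k.
Proof.
move=> k3 /existsP[c /forallP c_improper].
pose a (v : G) (i : 'I_k) := #|[set j : 'I_d.+1 | c (v, j) == i]|.
have [//||||c' c'_proper] := @colouring_of_weights G 'I_k d.+1 a.
- move=> v; rewrite -[RHS]card_ord -sum1_card.
  rewrite (partition_big (fun j => c (v, j)) xpredT) //=.
  by apply: eq_bigr => i _; rewrite /a -sum1dep_card.
- move=> v i; rewrite {1}/a card_gt0 => /set0Pn[j]; rewrite inE => /eqP cvj.
  have := c_improper (v, j).
  set N := [set _ | _]; rewrite -ltnS -add1n.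
  suff -> : a v i + \sum_(w | adj v w) a w i = #|(v, j) |: N|.
    by rewrite cardsU1; apply: leq_trans; rewrite leq_add2r leq_b1.
  transitivity (\sum_(w | (w == v) || adj v w) a w i).
    rewrite [RHS](bigD1 v) ?eqxx //=; congr (_ + _); apply: eq_bigl => w.
    by case: eqVneq => [->|_]; rewrite ?adj_irrefl ?andbT.
  rewrite /a; under eq_bigr do rewrite -sum1dep_card.
  rewrite pair_big_dep /= sum1dep_card; apply: eq_card => -[w l].
  rewrite !inE /= /strong_adj /= /complete_adj xpair_eqE (eq_sym w) (eq_sym l).
  rewrite cvj; case: (eqVneq v w) => [<-|_]; case: (eqVneq j l) => [<-|_] //=;
    by rewrite ?cvj ?eqxx ?adj_irrefl ?orbF ?andbT //= andbF orbF.
- by rewrite card_ord.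
apply/existsP; exists [ffun v => c' v]; apply/forallP => u; apply/forallP => v.
by rewrite !ffunE; apply/implyP/c'_proper.
Qed.

Theorem theorem16 (G : sgraph) (d : nat) (chiG : chi G <= 4) :
  chi G = chi_improper (strong_product G (complete_graph d.+1)) d.
Proof.
apply/eqP; rewrite eqn_leq chi_improper_le andbT.
rewrite /chi_improper; case: ex_minnP => k colk _.
case: (leqP k 3) => [k3|]; last exact: leq_trans.
rewrite /chi; case: ex_minnP => m _; apply.
exact: colourable_of_improper colk.
Qed.
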